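(* Let $p$ be a prime. (a) Hausdorff dimensions in the Riordan group $\mathcal{R}(\mathbb{F}_p)$ depend on the choice of the filtration: there exist two filtrations of $\mathcal{R}(\mathbb{F}_p)$ and a closed subgroup of $\mathcal{R}(\mathbb{F}_p)$ whose Hausdorff dimensions with respect to the two filtrations are different. (b) Let $(I,J)$ be an admissible index-pair. If $\mathcal{R}(I,J)$ is just infinite, then either $I$ or $J$ is the empty set.
   Context: Let $\mathbb{N}=\{1,2,\dots\}$. - $\mathcal{H}(\mathbb{F}_p)=\{1+a_1x+a_2x^2+\cdots\in\mathbb{F}_p[[x]]\}$ is a group under multiplication. - $\mathcal{N}(\mathbb{F}_p)=\{x+a_2x^2+a_3x^3+\cdots\in\mathbb{F}_p[[x]]\}$ is a group under $h\circ g:=g(h)$. - $\mathcal{R}(\mathbb{F}_p)=\mathcal{H}(\mathbb{F}_p)\rtimes\mathcal{N}(\mathbb{F}_p)$ with $(h_1,g_1)(h_2,g_2)=(h_1\cdot h_2(g_1),\,g_2(g_1))$. - For $n\ge1$, $\mathcal{H}^n(\mathbb{F}_p)$ is the set of $h\in\mathcal{H}(\mathbb{F}_p)$ of the form $1+a_nx^n+a_{n+1}x^{n+1}+\cdots$, and $\mathcal{N}^n(\mathbb{F}_p)$ is the set of $g\in\mathcal{N}(\mathbb{F}_p)$ of the form $x+a_{n+1}x^{n+1}+a_{n+2}x^{n+2}+\cdots$. - $\mathcal{R}(\mathbb{F}_p)$ is a profinite group for the topology in which the normal subgroups $\mathcal{H}^n(\mathbb{F}_p)\rtimes\mathcal{N}^n(\mathbb{F}_p)$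 form a base of neighbourhoods of the identity; subgroups carry the subspace topology. A filtration of a profinite group $G$ is a descending chain $G=G_1\unrhd G_2\unrhd\cdots$ of open normal subgroups forming a base of neighbourhoods of the identity. It defines the invariant metric $d(g,h)=\inf\{1/|G:G_n| : gh^{-1}\in G_n\}$, and the Hausdorff dimension of a closed subgroup $H$ with respect to the filtration is its Hausdorff dimension with respect to $d$; it is known that it equals $\liminf_{n\to\infty}\frac{\log|HG_n/G_n|}{\log|G/G_n|}$. For $I,J\subseteq\mathbb{N}$ let $\mathcal{R}(I,J)=\{(1+\sum_{i\in I}a_ix^i,\;x+\sum_{j\in J}b_jx^{j+1}) : a_i,b_j\in\mathbb{F}_p\}$. The pair $(I,J)$ is an admissible index-pair if $\mathcal{R}(I,J)$ is a subgroup of $\mathcal{R}(\mathbb{F}_p)$. An infinite topological group is just infinite if every non-trivial closed normal subgroup has finite index. *)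

(* Defs.v *)
From HB Require Import structures.
From mathcomp Require Import all_boot all_order all_algebra finmap.
From mathcomp Require Import all_classical all_reals all_analysis.
From mathcomp Require Import zify.

Set Implicit Arguments.
Unset Strict Implicit.
Unset Printing Implicit Defensive.

Import Order.TTheory GRing.Theory Num.Theory.

Local Open Scope classical_set_scope.
Local Open Scope ring_scope.

(** * Formal power series as coefficient sequences

    The series [sum_n a_n x^n] is the function [n |-> a_n]. *)

Section Series.
Variable K : fieldType.
Implicit Types (f g h : nat -> K) (n k : nat) (p q : {poly K}).

Definition fps_one : nat -> K := fun n => (n == 0%N)%:R.

Definition fps_X : nat -> K := fun n => (n == 1%N)%:R.

Definition fps_mul f g : nat -> K :=
  fun n => \sum_(i < n.+1) f i * g (n - i)%N.

Definition fps_pow g k : nat -> K := iter k (fps_mul g) fps_one.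

(* The series f(g).  It is only meaningful when g has no constant term: then
   g ^ k contributes nothing to the coefficient of x^n for k > n. *)
Definition fps_comp f g : nat -> K :=
  fun n => \sum_(k < n.+1) f k * fps_pow g k n.

(* The identities below are transferred from polynomials by truncation. *)

Definition eq_upto n f g := forall k, (k < n)%N -> f k = g k.

Lemma fps_mul_upto n f f' g g' :
  eq_upto n f f' -> eq_upto n g g' -> eq_upto n (fps_mul f g) (fps_mul f' g').
Proof.
move=> ff' gg' k kn; apply: eq_bigr => i _; rewrite ff' ?gg' //; have := ltn_ord i; lia.
Qed.

Lemma fps_pow_upto n g g' k :
  eq_upto n g g' -> eq_upto n (fps_pow g k) (fps_pow g' k).
Proof. by move=> gg'; elim: k => [//|k IH]; apply: fps_mul_upto. Qed.

Lemma fps_comp_upto n f f' g g' :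
  eq_upto n f f' -> eq_upto n g g' ->
  eq_upto n (fps_comp f g) (fps_comp f' g').
Proof.
move=> ff' gg' k kn; apply: eq_bigr => i _.
rewrite ff'; last by have := ltn_ord i; lia.
by rewrite (fps_pow_upto _ gg').
Qed.

Let tr n f : {poly K} := \poly_(i < n) f i.

Let cf p : nat -> K := fun i => p`_i.

Let cf_tr n f : eq_upto n (cf (tr n f)) f.
Proof. by move=> k kn; rewrite /cf coef_poly kn. Qed.

Let cfM p q : cf (p * q) = fps_mul (cf p) (cf q).
Proof. by apply/funext => n; rewrite /cf coefM. Qed.

Let cf1 : cf 1 = fps_one.
Proof. by apply/funext => n; rewrite /cf coef1. Qed.

Let cfX : cf 'X = fps_X.
Proof. by apply/funext => n; rewrite /cf coefX. Qed.

Let cf_exp p k : cf (p ^+ k) = fps_pow (cf p) k.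
Proof. by elim: k => [|k IH]; rewrite ?expr0 ?cf1 // exprS cfM IH. Qed.

Let coef_exp_low q k n : q`_0 = 0 -> (n < k)%N -> (q ^+ k)`_n = 0.
Proof.
move=> q0 nk; rewrite -(poly_take_drop 1 q).
have -> : take_poly 1 q = 0.
  by apply/polyP => -[|i]; rewrite coef_take_poly coef0.
by rewrite add0r exprMn -exprM mul1n coefMXn nk.
Qed.

Let cf_comp p q : q`_0 = 0 -> cf (p \Po q) = fps_comp (cf p) (cf q).
Proof.
move=> q0; apply/funext => n; rewrite /cf coef_comp_poly /fps_comp.
under [RHS]eq_bigr => k _ do rewrite -cf_exp.
pose F k := p`_k * (q ^+ k)`_n.
have E m : (forall k, (m <= k)%N -> F k = 0) ->
    \sum_(k < m) F k = \sum_(k < (size p + n.+1)%N) F k.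
  move=> Fm; have [lem|/ltnW lem] := leqP m (size p + n.+1).
    rewrite (big_ord_widen _ F lem) [RHS](bigID (fun k : 'I__ => (k < m)%N)) /=.
    rewrite [X in _ = _ + X]big1 ?addr0 // => i; rewrite -leqNgt; exact: Fm.
  rewrite (big_ord_widen _ F lem) [LHS](bigID
    (fun k : 'I__ => (k < size p + n.+1)%N)) /=.
  rewrite [X in _ + X = _]big1 ?addr0 // => i; rewrite -leqNgt => le.
  rewrite /F nth_default ?mul0r //; exact: leq_trans (leq_addr _ _) le.
rewrite (E (size p)) ?(E n.+1) // => k le; rewrite /F.
  by rewrite coef_exp_low ?mulr0.
by rewrite nth_default ?mul0r.
Qed.

Lemma fps_mulC f g : fps_mul f g = fps_mul g f.
Proof.
apply/funext => n; rewrite -(fps_mul_upto (@cf_tr n.+1 f) (@cf_tr n.+1 g)) //.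
by rewrite -cfM mulrC cfM (fps_mul_upto (@cf_tr n.+1 g) (@cf_tr n.+1 f)).
Qed.

Lemma fps_mulA f g h : fps_mul f (fps_mul g h) = fps_mul (fps_mul f g) h.
Proof.
apply/funext => n; have [[F G] H] := (@cf_tr n.+1 f, @cf_tr n.+1 g, @cf_tr n.+1 h).
rewrite -(fps_mul_upto F (fps_mul_upto G H)) //.
rewrite -(fps_mul_upto (fps_mul_upto F G) H) //.
by rewrite -!cfM mulrA.
Qed.

Lemma fps_mul1 f : fps_mul f fps_one = f.
Proof.
apply/funext => n; have F := @cf_tr n.+1 f.
rewrite -(fps_mul_upto F (fun _ _ => erefl)) // -cf1 -cfM mulr1.
exact: F.
Qed.

Lemma fps_1mul f : fps_mul fps_one f = f.
Proof. by rewrite fps_mulC fps_mul1. Qed.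

Let tr0 n g : g 0%N = 0 -> (tr n.+1 g)`_0 = 0.
Proof. by move=> g0; rewrite coef_poly. Qed.

Lemma fps_comp0 f g : fps_comp f g 0%N = f 0%N.
Proof. by rewrite /fps_comp big_ord1 /= /fps_one mulr1. Qed.

Lemma fps_comp1 f g : g 0%N = 0 -> fps_comp f g 1%N = f 1%N * g 1%N.
Proof.
move=> g0; rewrite /fps_comp big_ord_recr big_ord1 /= /fps_one mulr0 add0r.
by rewrite [fps_mul _ _]fps_mul1.
Qed.

Lemma fps_compA f g h : g 0%N = 0 -> h 0%N = 0 ->
  fps_comp (fps_comp f g) h = fps_comp f (fps_comp g h).
Proof.
move=> g0 h0; apply/funext => n.
have [[F G] H] := (@cf_tr n.+1 f, @cf_tr n.+1 g, @cf_tr n.+1 h).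
rewrite -(fps_comp_upto (fps_comp_upto F G) H) //.
rewrite -(fps_comp_upto F (fps_comp_upto G H)) //.
rewrite -!cf_comp ?tr0 // ?comp_polyA //.
by rewrite -[LHS]/(cf _ 0%N) cf_comp ?tr0 // fps_comp0 /cf tr0.
Qed.

Lemma fps_comp_mul f g h : h 0%N = 0 ->
  fps_comp (fps_mul f g) h = fps_mul (fps_comp f h) (fps_comp g h).
Proof.
move=> h0; apply/funext => n.
have [[F G] H] := (@cf_tr n.+1 f, @cf_tr n.+1 g, @cf_tr n.+1 h).
rewrite -(fps_comp_upto (fps_mul_upto F G) H) //.
rewrite -(fps_mul_upto (fps_comp_upto F H) (fps_comp_upto G H)) //.
by rewrite -cfM -!cf_comp ?tr0 // -cfM comp_polyM.
Qed.

Lemma fps_compX f : fps_comp f fps_X = f.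
Proof.
apply/funext => n; have F := @cf_tr n.+1 f.
rewrite -(fps_comp_upto F (fun _ _ => erefl)) // -cfX -cf_comp ?coefX //.
by rewrite comp_polyXr; apply: F.
Qed.

Lemma fps_Xcomp g : g 0%N = 0 -> fps_comp fps_X g = g.
Proof.
move=> g0; apply/funext => n; have G := @cf_tr n.+1 g.
rewrite -(fps_comp_upto (fun _ _ => erefl) G) // -cfX -cf_comp ?tr0 //.
by rewrite comp_polyX; apply: G.
Qed.

Lemma fps_one_comp g : g 0%N = 0 -> fps_comp fps_one g = fps_one.
Proof.
move=> g0; apply/funext => n; have G := @cf_tr n.+1 g.
rewrite -(fps_comp_upto (fun _ _ => erefl) G) // -cf1 -cf_comp ?tr0 //.
by rewrite -polyC1 comp_polyC.
Qed.

Lemma fps_mul0 f g : fps_mul f g 0%N = f 0%N * g 0%N.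
Proof. by rewrite /fps_mul big_ord1. Qed.

Lemma fps_pow_diag g n : g 0%N = 0 -> g 1%N = 1 -> fps_pow g n n = 1.
Proof.
move=> g0 g1; elim: n => [//|n IH]; rewrite /fps_pow /= -/(fps_pow g n).
rewrite /fps_mul 2!big_ord_recl /= g0 mul0r add0r /bump /= g1 mul1r subn1 /=.
rewrite IH big1 ?addr0 // => i _.
rewrite -(fps_pow_upto _ (@cf_tr n.+1 g)); last by rewrite !add1n; lia.
rewrite -cf_exp /cf coef_exp_low ?mulr0 ?tr0 //.
by rewrite !add1n; have := ltn_ord i; lia.
Qed.

(* The solution s of the unitriangular system
   sum_(k <= n) s_k * M k n = c_n, used to build inverses. *)
Fixpoint tri_seq (M : nat -> nat -> K) (c : nat -> K) n : seq K :=
  if n is m.+1 then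
    let s := tri_seq M c m in
    rcons s (c m - \sum_(k < m) s`_k * M k m)
  else [::].

Definition tri_sol M c : nat -> K := fun n => (tri_seq M c n.+1)`_n.

Lemma size_tri_seq M c n : size (tri_seq M c n) = n.
Proof. by elim: n => //= n IH; rewrite size_rcons IH. Qed.

Lemma nth_tri_seq M c n k : (k < n)%N -> (tri_seq M c n)`_k = tri_sol M c k.
Proof.
elim: n => // n IH; rewrite ltnS leq_eqVlt => /predU1P[-> //|kn].
by rewrite /= nth_rcons size_tri_seq kn IH.
Qed.

Lemma tri_solP M c n : M n n = 1 ->
  \sum_(k < n.+1) tri_sol M c k * M k n = c n.
Proof.
move=> M1; rewrite big_ord_recr /= {2}/tri_sol /= nth_rcons size_tri_seq.
rewrite ltnn eqxx M1 mulr1.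
under eq_bigr => k _ do rewrite -(@nth_tri_seq M c n) //.
by rewrite addrC subrK.
Qed.

Definition fps_inv f : nat -> K := tri_sol (fun k n => f (n - k)%N) fps_one.

Lemma fps_mulV f : f 0%N = 1 -> fps_mul f (fps_inv f) = fps_one.
Proof.
move=> f0; rewrite fps_mulC; apply/funext => n.
by rewrite /fps_mul tri_solP // subnn.
Qed.

(* The series u such that u(g) = c. *)
Definition fps_divcomp c g : nat -> K := tri_sol (fun k n => fps_pow g k n) c.

Lemma fps_divcompK c g : g 0%N = 0 -> g 1%N = 1 ->
  fps_comp (fps_divcomp c g) g = c.
Proof.
by move=> g0 g1; apply/funext => n; rewrite /fps_comp tri_solP ?fps_pow_diag.
Qed.

End Series.

(** * The Riordan group *)

(* Pairs (h, g) with h = 1 + a_1 x + ... and g = x + b_2 x^2 + ... *)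
Record riordan (K : fieldType) := Riordan {
  rh : nat -> K;
  rg : nat -> K;
  rcond : [&& rh 0%N == 1, rg 0%N == 0 & rg 1%N == 1] }.

HB.instance Definition _ K := gen_eqMixin (riordan K).
HB.instance Definition _ K := gen_choiceMixin (riordan K).

Section RiordanGroup.
Variable K : fieldType.
Implicit Types x y z : riordan K.

Lemma rh0 x : rh x 0%N = 1.
Proof. by case: x => h g /= /and3P[/eqP]. Qed.

Lemma rg0 x : rg x 0%N = 0.
Proof. by case: x => h g /= /and3P[_ /eqP]. Qed.

Lemma rg1 x : rg x 1%N = 1.
Proof. by case: x => h g /= /and3P[_ _ /eqP]. Qed.

Lemma riordan_ext x y : rh x = rh y -> rg x = rg y -> x = y.
Proof.
case: x y => [h g c] [h' g' c'] /= hh' gg'; subst h' g'.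
by congr Riordan; apply: bool_irrelevance.
Qed.

Fact riordan_one_subproof :
  [&& fps_one K 0%N == 1, fps_X K 0%N == 0 & fps_X K 1%N == 1].
Proof. by rewrite /fps_one /fps_X /= !eqxx. Qed.

Definition riordan_one : riordan K := Riordan riordan_one_subproof.

Fact riordan_mul_subproof x y :
  [&& fps_mul (rh x) (fps_comp (rh y) (rg x)) 0%N == 1,
      fps_comp (rg y) (rg x) 0%N == 0 & fps_comp (rg y) (rg x) 1%N == 1].
Proof.
rewrite fps_mul0 !fps_comp0 fps_comp1 ?rg0 // !rh0 !rg1.
by rewrite mulr1 !eqxx.
Qed.

(* (h1, g1) (h2, g2) = (h1 * h2(g1), g2(g1)) *)
Definition riordan_mul x y : riordan K := Riordan (riordan_mul_subproof x y).

Fact riordan_inv_subproof x :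
  [&& fps_divcomp (fps_inv (rh x)) (rg x) 0%N == 1,
      fps_divcomp (fps_X K) (rg x) 0%N == 0 &
      fps_divcomp (fps_X K) (rg x) 1%N == 1].
Proof.
have E c : fps_comp (fps_divcomp c (rg x)) (rg x) = c.
  by rewrite fps_divcompK ?rg0 ?rg1.
have V := fps_mulV (rh0 x).
apply/and3P; split; apply/eqP.
- rewrite -(fps_comp0 _ (rg x)) E.
  by have := congr1 (fun f => f 0%N) V; rewrite fps_mul0 rh0 mul1r.
- by rewrite -(fps_comp0 _ (rg x)) E.
- have := congr1 (fun f => f 1%N) (E (fps_X K)).
  by rewrite fps_comp1 ?rg0 // rg1 mulr1.
Qed.

Definition riordan_inv x : riordan K := Riordan (riordan_inv_subproof x).

Lemma riordan_mulA : associative riordan_mul.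
Proof.
move=> x y z; apply: riordan_ext => /=; last by rewrite fps_compA ?rg0.
by rewrite fps_comp_mul ?rg0 // fps_mulA fps_compA ?rg0.
Qed.

Lemma riordan_mul1 : right_id riordan_one riordan_mul.
Proof.
move=> x; apply: riordan_ext => /=; last by rewrite fps_Xcomp ?rg0.
by rewrite fps_one_comp ?rg0 // fps_mul1.
Qed.

Lemma riordan_1mul : left_id riordan_one riordan_mul.
Proof. by move=> x; apply: riordan_ext => /=; rewrite fps_compX ?fps_1mul. Qed.

Lemma riordan_mulV : right_inverse riordan_one riordan_inv riordan_mul.
Proof.
move=> x; apply: riordan_ext => /=; last by rewrite fps_divcompK ?rg0 ?rg1.
by rewrite fps_divcompK ?rg0 ?rg1 // fps_mulV ?rh0.
Qed.

Lemma riordan_Vmul : left_inverse riordan_one riordan_inv riordan_mul.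
Proof.
move=> x; rewrite -[LHS]riordan_mul1 -{1}(riordan_mulV (riordan_inv x)).
rewrite riordan_mulA -(riordan_mulA _ x) riordan_mulV riordan_mul1.
exact: riordan_mulV.
Qed.

HB.instance Definition _ := isGroup.Build (riordan K)
  riordan_mulA riordan_1mul riordan_mul1 riordan_Vmul riordan_mulV.

Local Open Scope group_scope.

(* H^n x N^n.  For n = 0, as for n = 1, it is the whole group. *)
Definition riordan_base n : set (riordan K) :=
  [set x | (forall k, (0 < k < n)%N -> rh x k = 0) /\
           (forall k, (1 < k <= n)%N -> rg x k = 0)].

Definition riordan_open (A : set (riordan K)) :=
  forall x, A x -> exists n, forall u, riordan_base n u -> A (x * u).

Lemma riordan_baseS m n : (m <= n)%N -> riordan_base n `<=` riordan_base m.
Proof.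
move=> mn x [hx gx]; split => k /andP[k0 km].
  by apply: hx; rewrite k0 (leq_trans km).
by apply: gx; rewrite k0 (leq_trans km).
Qed.

Fact riordan_openT : riordan_open setT.
Proof. by move=> x _; exists 0%N. Qed.

Fact riordan_openI (A B : set (riordan K)) :
  riordan_open A -> riordan_open B -> riordan_open (A `&` B).
Proof.
move=> oA oB x [/oA[m Am] /oB[n Bn]]; exists (maxn m n) => u ux.
by split; [apply: Am|apply: Bn]; apply: riordan_baseS ux;
  rewrite ?leq_maxl ?leq_maxr.
Qed.

Fact riordan_openU (I : Type) (f : I -> set (riordan K)) :
  (forall i, riordan_open (f i)) -> riordan_open (\bigcup_i f i).
Proof. by move=> of_ x [i _ /of_[n fn]]; exists n => u /fn; exists i. Qed.

HB.instance Definition _ := isOpenTopological.Build (riordan K)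
  riordan_openT riordan_openI riordan_openU.

Definition riordan_cong n x y :=
  eq_upto n (rh x) (rh y) /\ eq_upto n.+1 (rg x) (rg y).

Lemma riordan_congM n x x' y y' : riordan_cong n x x' ->
  riordan_cong n y y' -> riordan_cong n (x * y) (x' * y').
Proof.
move=> [hx gx] [hy gy]; split; last exact: fps_comp_upto.
apply: fps_mul_upto => //; apply: fps_comp_upto => // k kn.
by apply: gx; apply: leq_trans kn _.
Qed.

Lemma riordan_base_cong n x : riordan_base n x <-> riordan_cong n x 1.
Proof.
split=> -[hx gx]; split.
- move=> [|k] kn; first by rewrite !rh0.
  by rewrite hx // -[RHS]/(fps_one K k.+1).
- move=> [|[|k]] kn; rewrite ?rg0 ?rg1 //.
  by rewrite gx // -[RHS]/(fps_X K k.+2).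
- by move=> [|k] // kn; rewrite hx.
- by move=> [|[|k]] // kn; rewrite gx.
Qed.

Lemma riordan_base1 n : riordan_base n 1.
Proof. exact/riordan_base_cong. Qed.

Lemma riordan_baseM n x y :
  riordan_base n x -> riordan_base n y -> riordan_base n (x * y).
Proof.
rewrite !riordan_base_cong => cx cy.
by have := riordan_congM cx cy; rewrite mulg1.
Qed.

Lemma riordan_baseV n x : riordan_base n x -> riordan_base n x^-1.
Proof.
rewrite !riordan_base_cong => cx.
have [] := @riordan_congM n x^-1 x^-1 x 1 _ cx; first by [].
rewrite mulVg mulg1 => h g.
by split=> k kn; [rewrite h|rewrite g].
Qed.

Lemma riordan_baseJ n x y : riordan_base n x -> riordan_base n (x ^ y).
Proof.
rewrite !riordan_base_cong => cx.
have c z : riordan_cong n z z by [].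
have := riordan_congM (c y^-1) (riordan_congM cx (c y)).
by rewrite mul1g mulVg.
Qed.

Lemma riordan_nbhsP x (A : set (riordan K)) :
  nbhs x A <-> exists n, forall u, riordan_base n u -> A (x * u).
Proof.
split=> [|[n An]].
  rewrite nbhsE => -[B [oB Bx] BA].
  by have [n Bn] := oB _ Bx; exists n => u /Bn /BA.
rewrite nbhsE; exists [set x * u | u in riordan_base n].
  split; last by exists 1; [exact: riordan_base1|rewrite mulg1].
  move=> _ [u bu <-]; exists n => v bv; exists (u * v); last by rewrite mulgA.
  exact: riordan_baseM.
by move=> _ [u bu <-]; apply: An.
Qed.

End RiordanGroup.

(** * Topological groups *)

HB.mixin Record isTopologicalGroup (T : Type) & Group T & Topological T
    := {
  mulg_continuous : continuous (fun xy : T * T => (xy.1 * xy.2)%g);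
  invg_continuous : continuous (fun x : T => x^-1%g) }.

#[short(type="topologicalGroupType")]
HB.structure Definition TopologicalGroup :=
  {T of Group T & Topological T & isTopologicalGroup T}.

Section RiordanTopologicalGroup.
Variable K : fieldType.
Local Open Scope group_scope.

Fact riordan_mul_continuous :
  continuous (fun xy : riordan K * riordan K => xy.1 * xy.2).
Proof.
move=> [x y] A /= /riordan_nbhsP[n An].
exists ([set x * u | u in riordan_base n],
        [set y * u | u in riordan_base n]) => /=.
  by split; apply/riordan_nbhsP; exists n => u bu; exists u.
move=> _ [/= [u bu <-] [v bv <-]].
have -> : x * u * (y * v) = x * y * (u ^ y * v) by rewrite conjgE !mulgA mulgK.
by apply: An; apply: riordan_baseM bv; apply: riordan_baseJ.
Qed.

Fact riordan_inv_continuous : continuous (fun x : riordan K => x^-1).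
Proof.
move=> x A /riordan_nbhsP[n An]; apply/riordan_nbhsP; exists n => u bu.
change (A (x * u)^-1); have -> : (x * u)^-1 = x^-1 * (u^-1 ^ x^-1).
  by rewrite invgM conjgE invgK !mulgA mulVg mul1g.
by apply: An; apply: riordan_baseJ; apply: riordan_baseV.
Qed.

HB.instance Definition _ := isTopologicalGroup.Build (riordan K)
  riordan_mul_continuous riordan_inv_continuous.

End RiordanTopologicalGroup.

Section TopologicalGroupTheory.
Variable T : topologicalGroupType.
Implicit Types (A H N : set T) (F : nat -> set T).
Local Open Scope group_scope.

Definition is_subgroup H := group_closed (mem H).

Definition is_normal_in N H :=
  [/\ is_subgroup N, N `<=` H & forall x y, H x -> N y -> N (y ^ x)].

Definition left_cosets H N : set (set T) :=
  [set [set x * y | y in N] | x in H].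

Definition finite_index H N := finite_set (left_cosets H N).

(* Equal to 0 when the index is infinite. *)
Definition index_in H N : nat := #|` fset_set (left_cosets H N)|.

(* The chain is indexed from 0: F 0 is the first term G_1 = G. *)
Definition is_filtration F :=
  [/\ F 0%N = setT,
      forall n, F n.+1 `<=` F n,
      forall n, open (F n) /\ is_normal_in (F n) setT
    & forall A, nbhs (1 : T) A -> exists n, F n `<=` A].

(* [closed] is taken in the subspace topology of H. *)
Definition just_infinite H :=
  infinite_set H /\
  forall N, is_normal_in N H -> closed (N : set (subspace H)) ->
    N <> [set 1] -> finite_index H N.

End TopologicalGroupTheory.

(** * Hausdorff dimension *)

Section HausdorffDimension.
Variables (R : realType) (T : Type) (d : T -> T -> R).
Local Open Scope ereal_scope.

Definition diameter (U : set T) : \bar R :=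
  ereal_sup [set (d xy.1 xy.2)%:E | xy in U `*` U].

(* diam(U)^s, with 0^0 = 1 for nonempty U and the value 0 for U empty. *)
Definition hausdorff_gauge (s : R) (U : set T) : \bar R :=
  if U == set0 then 0 else diameter U `^ s.

Definition hausdorff_content (s delta : R) (E : set T) : \bar R :=
  ereal_inf [set \sum_(0 <= i <oo) hausdorff_gauge s (U i) |
    U in [set U : nat -> set T | E `<=` \bigcup_i U i /\
                                 forall i, diameter (U i) <= delta%:E]].

Definition hausdorff_measure (s : R) (E : set T) : \bar R :=
  ereal_sup [set hausdorff_content s delta E |
    delta in [set delta : R | (0 < delta)%R]].

Definition hausdorff_dim (E : set T) : \bar R :=
  ereal_inf [set s%:E |
    s in [set s : R | (0 <= s)%R /\ hausdorff_measure s E = 0]].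

End HausdorffDimension.

Definition filtration_dist (R : realType) (T : topologicalGroupType)
    (F : nat -> set T) (x y : T) : R :=
  inf [set ((index_in setT (F n))%:R)^-1 | n in [set n | F n (x * y^-1)%g]].

Definition filtration_dim (R : realType) (T : topologicalGroupType)
    (F : nat -> set T) (H : set T) : \bar R :=
  hausdorff_dim (filtration_dist R F) H.

(** * Index-subgroups *)

Definition riordan_index (K : fieldType) (I J : set nat) : set (riordan K) :=
  [set x | (forall i, (0 < i)%N -> ~ I i -> rh x i = 0) /\
           (forall j, (0 < j)%N -> ~ J j -> rg x j.+1 = 0)].
Arguments riordan_index : clear implicits.

(* I and J are sets of positive integers. *)
Definition admissible (K : fieldType) (I J : set nat) :=
  [/\ I `<=` [set n | (0 < n)%N], J `<=` [set n | (0 < n)%N] &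
      is_subgroup (riordan_index K I J)].

(* Main.v *)
Require Import Defs.
From mathcomp Require Import all_boot all_order all_algebra.
From mathcomp Require Import all_classical all_reals all_analysis.
From mathcomp Require Import zify.

(** (b) If [j] is the largest element of [J], squaring [x + x^(j+1)] produces the
    monomial [x^((j+1)^2)]; so a nonempty [J] is infinite.  The cosets of the
    closed normal subgroup [R(I, 0)] are separated by the second component, so
    this subgroup then has infinite index, and it is non-trivial unless [I] is
    empty.

    (a) For [c >= 1] the subgroups [H^(n+1) x N^(cn+1)] form a filtration, of
    indices [q^((c+1)n)] with [q = #|K|], while the image of [H] in the [n]-th quotient has [q^n]
    elements.  Hence [H] has dimension [1/(c+1)], which depends on [c].  The upper
    bound comes from covering [H] by cosets.  For the lower bound, a set of
    diameter [r] meets [H] inside a cylinder of measure at most [r^(1/(c+1))], for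
    the uniform measure on the sequences of coefficients. *)

Set Implicit Arguments.
Unset Strict Implicit.
Unset Printing Implicit Defensive.

Import Order.TTheory GRing.Theory Num.Theory.

Local Open Scope classical_set_scope.
Local Open Scope ring_scope.

(** * Degrees and leading coefficients of powers and self-compositions of polynomials *)

Section SeriesDegree.
Variable K : fieldType.
Implicit Types (f g : nat -> K) (d k n : nat).

Lemma fps_pow_degree g d k n : (forall i, (d < i)%N -> g i = 0) ->
  (d * k < n)%N -> fps_pow g k n = 0.
Proof.
move=> gd; elim: k n => [|k IH] n lt.
  by rewrite /fps_pow /= /fps_one; case: n lt => //; rewrite muln0.
rewrite /fps_pow /= -/(fps_pow g k) /fps_mul big1 // => i _.
have [/gd->|le] := ltnP d i; first by rewrite mul0r.
by rewrite IH ?mulr0 //; rewrite mulnS in lt; lia.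
Qed.

Lemma fps_pow_lead g d k : (forall i, (d < i)%N -> g i = 0) ->
  fps_pow g k (d * k)%N = g d ^+ k.
Proof.
move=> gd; elim: k => [|k IH]; first by rewrite muln0.
rewrite /fps_pow /= -/(fps_pow g k) /fps_mul.
have dlt : (d < (d * k.+1).+1)%N by rewrite ltnS leq_pmulr.
rewrite (bigD1 (Ordinal dlt)) //= [X in fps_pow g k X](_ : _ = d * k)%N; last first.
  by rewrite mulnS addKn.
rewrite IH exprS big1 ?addr0 // => i.
rewrite -val_eqE /= => id.
have [/gd->|le] := ltnP d i; first by rewrite mul0r.
rewrite (fps_pow_degree gd) ?mulr0 //.
by have := mulnS d k; move/eqP: id; lia.
Qed.

(** The terms with [k > d] have coefficient zero, and for [k < d] the power [g ^ k] has degree at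
    most [d * k < d * d]. Only [k = d] reaches the coefficient of [x^(d * d)]. *)
Lemma fps_comp_self_lead g d : (0 < d)%N -> (forall i, (d < i)%N -> g i = 0) ->
  fps_comp g g (d * d)%N = g d ^+ d.+1.
Proof.
move=> d0 gd; rewrite /fps_comp.
have dlt : (d < (d * d).+1)%N by rewrite ltnS leq_pmulr.
rewrite (bigD1 (Ordinal dlt)) //= fps_pow_lead // exprS big1 ?addr0 // => i.
rewrite -val_eqE /= => id.
have [/gd->|le] := ltnP d i; first by rewrite mul0r.
rewrite (fps_pow_degree gd) ?mulr0 // ltn_pmul2l //.
by move/eqP: id; lia.
Qed.

End SeriesDegree.

Lemma is_subgroupP (T : topologicalGroupType) (H : set T) :
  is_subgroup H <-> H 1%g /\ forall x y, H x -> H y -> H (x * y^-1)%g.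
Proof.
split=> -[H1 HB]; split.
- exact: set_mem H1.
- by move=> x y /mem_set Hx /mem_set Hy; apply: set_mem; apply: HB.
- exact: mem_set.
- by move=> x y /set_mem Hx /set_mem Hy; apply: mem_set; apply: HB.
Qed.

(** * Congruences between Riordan pairs, and the normal subgroups they define *)

Section RiordanCongruence.
Variable K : fieldType.
Implicit Types (x y z : riordan K) (a b n : nat) (I J : set nat).
Local Open Scope group_scope.

Definition riordan_eqm a b x y := eq_upto a (rh x) (rh y) /\ eq_upto b (rg x) (rg y).

(* [riordan_ker a b.+1] is [H^a x N^b]. *)
Definition riordan_ker a b : set (riordan K) := [set x | riordan_eqm a b x 1].

Lemma riordan_eqm_refl a b x : riordan_eqm a b x x.
Proof. by []. Qed.

Lemma riordan_eqm_sym a b x y : riordan_eqm a b x y -> riordan_eqm a b y x.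
Proof. by move=> [hE gE]; split=> k kn; rewrite ?hE ?gE. Qed.

Lemma riordan_eqm_trans a b x y z :
  riordan_eqm a b x y -> riordan_eqm a b y z -> riordan_eqm a b x z.
Proof.
by move=> [hE gE] [hE' gE']; split=> k kn; [rewrite hE ?hE'|rewrite gE ?gE'].
Qed.

Lemma riordan_eqm_le a b a' b' x y : (a' <= a)%N -> (b' <= b)%N ->
  riordan_eqm a b x y -> riordan_eqm a' b' x y.
Proof.
move=> aa bb [hE gE]; split=> k kn; [apply: hE|apply: gE];
  exact: leq_trans kn _.
Qed.

(* The condition [a <= b] is needed because the first component of [x * y]
   involves [rg x]. *)
Lemma riordan_eqmM a b x x' y y' : (a <= b)%N -> riordan_eqm a b x x' ->
  riordan_eqm a b y y' -> riordan_eqm a b (x * y) (x' * y').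
Proof.
move=> ab [hx gx] [hy gy]; split; last exact: fps_comp_upto.
apply: fps_mul_upto => //; apply: fps_comp_upto => // k kn.
by apply: gx; apply: leq_trans kn _.
Qed.

(** This turns the condition on [x * y^-1] in [filtration_dist] into an agreement of
    coefficients. *)
Lemma mem_riordan_ker_mulV a b x y : (a <= b)%N ->
  riordan_ker a b (x * y^-1) <-> riordan_eqm a b x y.
Proof.
move=> ab; split=> xy.
  have := riordan_eqmM ab xy (riordan_eqm_refl a b y).
  by rewrite -mulgA mulVg mulg1 mul1g.
have := riordan_eqmM ab xy (riordan_eqm_refl a b y^-1).
by rewrite mulgV.
Qed.

Lemma riordan_ker_normal a b : (a <= b)%N ->
  is_normal_in (riordan_ker a b) setT.
Proof.
move=> ab; split => //.
  apply/is_subgroupP; split=> // x y xk yk.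
  apply/mem_riordan_ker_mulV => //.
  exact: riordan_eqm_trans xk (riordan_eqm_sym yk).
move=> x y _ yk.
have := riordan_eqmM ab (riordan_eqm_refl a b x^-1)
  (riordan_eqmM ab yk (riordan_eqm_refl a b x)).
by rewrite mul1g mulVg.
Qed.

Lemma riordan_base_eqm n x y :
  riordan_base n x -> riordan_eqm n n.+1 (y * x) y.
Proof.
move=> /riordan_base_cong xb.
by have := riordan_eqmM (leqnSn n) (riordan_eqm_refl n n.+1 y) xb; rewrite mulg1.
Qed.

Lemma riordan_ker_open a b : open (riordan_ker a b).
Proof.
rewrite openE => x xk; apply/riordan_nbhsP; exists (maxn a b) => u ub.
apply: riordan_eqm_trans xk; apply: riordan_eqm_le (riordan_base_eqm x ub); lia.
Qed.

Lemma riordan_left_coset a b x : (a <= b)%N ->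
  [set x * y | y in riordan_ker a b] = riordan_eqm a b x.
Proof.
move=> ab; apply/seteqP; split=> [_ [y yk <-]|z xz].
  have := riordan_eqmM ab (riordan_eqm_refl a b x) (riordan_eqm_sym yk).
  by rewrite mulg1.
exists (x^-1 * z); last by rewrite mulgA mulgV mul1g.
have := riordan_eqmM ab (riordan_eqm_refl a b x^-1) (riordan_eqm_sym xz).
by rewrite mulVg.
Qed.

(** A point outside has a non-zero coefficient at a forbidden index, and this coefficient is
    constant on a basic neighbourhood of the point. *)
Lemma closed_riordan_index I J : closed (riordan_index K I J).
Proof.
rewrite -openC openE => x /= xN.
rewrite /interior /= riordan_nbhsP.
have [[i i0 [Ii xi]]|xI] :=
    pselect (exists2 i, (0 < i)%N & ~ I i /\ rh x i <> 0%R).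
  exists i.+1 => u ub [uI _]; apply: xi; rewrite -(uI i i0 Ii).
  by have [-> //] := riordan_base_eqm x ub.
have [[j j0 [Jj xj]]|xJ] :=
    pselect (exists2 j, (0 < j)%N & ~ J j /\ rg x j.+1 <> 0%R).
  exists j.+1 => u ub [_ uJ]; apply: xj; rewrite -(uJ j j0 Jj).
  by have [_ -> //] := riordan_base_eqm x ub.
exfalso; apply: xN; split => [i i0 Ii|j j0 Jj]; apply: contrapT => ne.
  by apply: xI; exists i.
by apply: xJ; exists j.
Qed.

End RiordanCongruence.

Lemma is_subgroupM (T : topologicalGroupType) (H : set T) (x y : T) :
  is_subgroup H -> H x -> H y -> H (x * y)%g.
Proof.
move=> /is_subgroupP[H1 H_div] Hx Hy; rewrite -[y]invgK; apply: (H_div) => //.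
by rewrite -[(y^-1)%g]mul1g; apply: H_div.
Qed.

(** * Just infinite index-subgroups *)

Section JustInfinite.
Variable K : fieldType.
Implicit Types (x y : riordan K) (i j : nat) (I J : set nat).

Fact riordan_addX_subproof j :
  [&& fps_one K 0%N == 1, ((0 == 1) || (0 == j.+1))%N%:R == 0 :> K &
      ((1 == 1) || (1 == j.+1))%N%:R == 1 :> K].
Proof. by rewrite /fps_one /= !eqxx. Qed.

(** The disjunction, rather than a sum, keeps the coefficient of [x] equal to 1 even for [j = 0]. *)
Definition riordan_addX j : riordan K :=
  @Riordan K (fps_one K) (fun n => ((n == 1) || (n == j.+1))%N%:R)
    (riordan_addX_subproof j).

Fact riordan_add1_subproof i :
  [&& (0 == i.+1)%N%:R + fps_one K 0%N == 1 :> K,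
      fps_X K 0%N == 0 & fps_X K 1%N == 1].
Proof. by rewrite /fps_one /fps_X /= add0r !eqxx. Qed.

Definition riordan_add1 i : riordan K :=
  @Riordan K (fun n => (n == i.+1)%:R + fps_one K n) (fps_X K)
    (riordan_add1_subproof i).

Lemma riordan_index_addX I J j : J j -> riordan_index K I J (riordan_addX j).
Proof.
move=> Jj; split=> [[|i] //|k k0 Jk /=].
by case: eqP => [[k1]|_]; [rewrite k1 in k0|case: eqP => // -[kj]; subst k].
Qed.

Lemma admissible_subset_infinite I J : admissible K I J -> J !=set0 ->
  infinite_set J.
Proof.
move=> [_ J_gt0 sgIJ] [j0 Jj0] /finite_seqP[s Js].
  have js j : J j -> (j <= \max_(i <- s) i)%N.
    by rewrite Js => sj; exact: (@leq_bigmax_seq _ s xpredT id j sj).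
have [j Jj jmax] : exists2 j, J j & forall i, J i -> (i <= j)%N.
  have exJ : exists j, `[< J j >] by exists j0; apply/asboolP.
  have ubJ j : `[< J j >] -> (j <= \max_(i <- s) i)%N by move=> /asboolP/js.
  have [j /asboolP Jj jmax] := ex_maxnP exJ ubJ.
  by exists j => // i Ji; apply: jmax; apply/asboolP.
(* Indices in [J] are one less than exponents, so [x^((j+1)^2)] has index [(j+1)^2 - 1]. This
   exceeds [j] because [j > 0], so the coefficient should vanish in the square, but it is 1. *)
have [_ /(_ (j.+1 * j.+1).-1)] :=
  is_subgroupM sgIJ (riordan_index_addX I Jj) (riordan_index_addX I Jj).
have j_gt0 := J_gt0 _ Jj; rewrite /= in j_gt0.
have NJ : ~ J (j.+1 * j.+1).-1 by move=> /jmax; rewrite mulnS; nia.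
move=> /(_ _ NJ); rewrite prednK // => /(_ ltac:(by rewrite mulnS; lia)).
rewrite /= fps_comp_self_lead //= ?eqxx ?orbT ?expr1n.
  by move/eqP; rewrite oner_eq0.
by move=> i ij; case: eqP => [|_]; [lia|case: eqP => //; lia].
Qed.

Lemma riordan_index_set0P I J x :
  riordan_index K I set0 x <-> riordan_index K I J x /\ rg x = fps_X K.
Proof.
split=> [[xI x0]|[[xI _] gx]]; last first.
  by split=> // j j0 _; rewrite gx /fps_X; case: j j0.
split; first by split=> // j j0 _; apply: x0.
by apply/funext => -[|[|j]]; rewrite ?rg0 ?rg1 // x0.
Qed.

(** [R(I, 0)] is the kernel of the projection of [R(I, J)] to the second component. *)
Lemma riordan_index_set0_normal I J : is_subgroup (riordan_index K I J) ->
  is_normal_in (riordan_index K I set0) (riordan_index K I J).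
Proof.
move=> sg; have /is_subgroupP[sg1 sgB] := sg.
have rgX : fps_X K = rg (1%g : riordan K) by [].
have idl x y : rg y = fps_X K -> rg (x * y)%g = rg x.
  by move=> gy; rewrite /= gy fps_Xcomp ?rg0.
have idr x y : rg x = fps_X K -> rg (x * y)%g = rg y.
  by move=> gx; rewrite /= gx fps_compX.
split.
- apply/is_subgroupP; split; first by apply/(riordan_index_set0P _ J).
  move=> x y /(riordan_index_set0P _ J)[Hx gx] /(riordan_index_set0P _ J)[Hy gy].
  apply/(riordan_index_set0P _ J); split; first exact: sgB.
  by rewrite (idr _ _ gx) -(idr _ (y^-1)%g gy) mulgV.
- by move=> x /(riordan_index_set0P _ J)[].
- move=> x y Hx /(riordan_index_set0P _ J)[Hy gy].
  apply/(riordan_index_set0P _ J); split.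
    apply: is_subgroupM => //; last exact: is_subgroupM.
    by rewrite -[(x^-1)%g]mul1g; apply: sgB.
  have -> : rg (y ^ x)%g = fps_comp (rg (y * x)%g) (rg (x^-1)%g) by [].
  by rewrite (idr _ _ gy) rgX -(mulVg x).
Qed.

Lemma riordan_index_set0_infinite_index I J : J `<=` [set j | (0 < j)%N] ->
  infinite_set J ->
  ~ finite_index (riordan_index K I J) (riordan_index K I set0).
Proof.
(* A coset is sent to an index [j > 0] such that it contains [riordan_addX j]. This index is unique,
   since all elements of a coset share their second component. With finitely many cosets the image
   would be finite, yet it contains [J]. *)
move=> J_gt0 infJ /(finite_image
  (fun C => xget 0%N [set j | (0 < j)%N /\ C (riordan_addX j)])) fin.
apply: infJ; apply: sub_finite_set fin => j Jj /=.
set C := [set (riordan_addX j * y)%g | y in riordan_index K I set0].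
exists C; first by exists (riordan_addX j) => //; apply: riordan_index_addX.
have Cj : C (riordan_addX j).
  by exists 1%g; [split=> -[|k]|rewrite mulg1].
case: xgetP => [i _ [i0 [y /(riordan_index_set0P _ J)[_ gy] /(congr1 (@rg K))]]|].
  rewrite /= gy fps_Xcomp //.
  move=> /(congr1 (fun g => g i.+1)) /=.
  rewrite eqxx orbT eqSS; case: i i0 => // i _ /=.
  by case: eqP => [[->]|_ /eqP]; rewrite // eq_sym oner_eq0.
by move=> /(_ j) []; split => //; apply: J_gt0.
Qed.

Lemma riordan_index_just_infinite I J : admissible K I J ->
  just_infinite (riordan_index K I J) -> I = set0 \/ J = set0.
Proof.
move=> adm [_ ji]; have [I_gt0 J_gt0 sg] := adm.
have [->|/set0P[i Ii]] := eqVneq I set0; first by left.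
have [->|/set0P J0] := eqVneq J set0; first by right.
exfalso; apply: (riordan_index_set0_infinite_index (I := I) J_gt0).
  exact: admissible_subset_infinite adm J0.
apply: ji.
- exact: riordan_index_set0_normal.
- by apply: closed_subspaceW; apply: closed_riordan_index.
have i0 := I_gt0 _ Ii; rewrite /= in i0 => N1.
(* The pair [(1 + x^i, x)] shows that [R(I, 0)] is non-trivial. *)
have : riordan_index K I set0 (riordan_add1 i.-1).
  split=> [k k0 Ik /=|[|j] //=]; rewrite prednK // /fps_one addrC.
  by case: k k0 Ik => //= k _ Ik; case: eqP => [ki|]; [subst i|rewrite addr0].
rewrite N1 => /(congr1 (fun x => rh x i)) /=.
rewrite prednK // eqxx [RHS]/(fps_one K i) /fps_one; case: i i0 {Ii N1} => //= i _.
by move/eqP; rewrite addr0 oner_eq0.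
Qed.

End JustInfinite.

(** * Covers of the space of infinite words by cylinders *)

Section CylinderCover.
Variables (R : realType) (A : finType).
Implicit Types (a : A) (w : seq A) (n : nat).

Let q : R := #|A|%:R.

Let q_gt0 : (0 < #|A|)%N -> 0 < q.
Proof. by rewrite ltr0n. Qed.

(** Agreement on the common positions means that the two cylinders meet; their intersection is then
    the cylinder of the longer word. *)
Definition cylinder_compat (a0 : A) (c : nat -> A) n w :=
  `[< forall j, (j < size w)%N -> (j < n)%N -> nth a0 w j = c j >].

(* The measure of the intersection of the cylinders of [w] and of
   [c 0, ..., c (n - 1)] for the uniform product measure. *)
Definition cylinder_mass (a0 : A) (c : nat -> A) n w : R :=
  (cylinder_compat a0 c n w)%:R * q ^- maxn (size w) n.

Lemma cylinder_compat_rcons a0 c n w a :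
  cylinder_compat a0 c n (rcons w a) =
  cylinder_compat a0 c n w && ((size w < n)%N ==> (a == c (size w))).
Proof.
apply/asboolP/andP => [H|[/asboolP H /implyP Ha] j].
  split; [apply/asboolP => j jw jn|apply/implyP => wn; apply/eqP].
    by rewrite -H ?size_rcons 1?nth_rcons ?jw // ltnW.
  by rewrite -H ?size_rcons // nth_rcons ltnn eqxx.
rewrite size_rcons ltnS leq_eqVlt nth_rcons => /predU1P[->|jw] jn.
  by rewrite ltnn eqxx; apply/eqP/Ha.
by rewrite jw H.
Qed.

(** If [w] is shorter than [n], only the letter [c (size w)] stays compatible and the mass does not
    change. Otherwise all [#|A|] letters do, each with the mass divided by [q]. *)
Lemma cylinder_mass_rcons a0 c n w :
  \sum_a cylinder_mass a0 c n (rcons w a) = cylinder_mass a0 c n w.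
Proof.
rewrite /cylinder_mass.
under eq_bigr => a _ do rewrite cylinder_compat_rcons size_rcons.
case: (cylinder_compat _ _ _ _) => /=; last first.
  by rewrite big1 ?mul0r // => a _; rewrite mul0r.
have [wn|nw] := ltnP (size w) n.
  rewrite (bigD1 (c (size w))) //= eqxx big1 => [|a /negPf->]; last by rewrite mul0r.
  by rewrite addr0 (maxn_idPr wn).
rewrite (maxn_idPl (leqW nw)) /= sumr_const !mul1r -mulr_natl -/q.
rewrite exprS invfM mulrA divff ?mul1r // gt_eqF // q_gt0 //.
by apply/card_gt0P; exists a0.
Qed.

Lemma cylinder_mass_ge0 a0 c n w : 0 <= cylinder_mass a0 c n w.
Proof. by rewrite mulr_ge0 // invr_ge0 exprn_ge0. Qed.

(* Extending a word digit by digit, one can keep the total mass of the cylinders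
   inside it below the measure of its own cylinder. *)
Lemma cylinder_cover_mass (c : nat -> nat -> A) (n : nat -> nat) :
  (forall x : nat -> A, exists i, forall j, (j < n i)%N -> x j = c i j) ->
  (1 <= \sum_(0 <= i <oo) (q ^- n i)%:E)%E.
Proof.
move=> cover; rewrite leNgt; apply/negP => lt1.
pose a0 := c 0%N 0%N.
have q0 : 0 < q by rewrite q_gt0 //; apply/card_gt0P; exists a0.
pose mass w := (\sum_(0 <= i <oo) (cylinder_mass a0 (c i) (n i) w)%:E)%E.
have mass_rcons w : (\sum_a mass (rcons w a) = mass w)%E.
  rewrite /mass -nneseries_sum; last by move=> *; rewrite lee_fin cylinder_mass_ge0.
  by apply: eq_eseriesr => i _; rewrite sumEFin cylinder_mass_rcons.
(* Some letter qualifies whenever [mass w] is below [q ^- size w]: otherwise summing over all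
   letters contradicts [mass_rcons]. The default [a0] is then never taken. *)
pose next w := odflt a0 [pick a | (mass (rcons w a) < (q ^- (size w).+1)%:E)%E].
have nextP w : (mass w < (q ^- size w)%:E ->
    mass (rcons w (next w)) < (q ^- (size w).+1)%:E)%E.
  move=> mw; rewrite /next; case: pickP => [a //|none] /=.
  exfalso; move: mw; rewrite ltNge => /negP; apply.
  have -> : q ^- size w = \sum_(a : A) q ^- (size w).+1.
    by rewrite sumr_const -mulr_natl -/q exprS invfM mulrA divff ?gt_eqF ?mul1r.
  rewrite -mass_rcons -sumEFin; apply: lee_sum => a _.
  by rewrite leNgt none.
pose word := fix word k := if k is k'.+1 then rcons (word k') (next (word k')) else [::].
have size_word k : size (word k) = k by elim: k => //= k IH; rewrite size_rcons IH.
have mass_word k : (mass (word k) < (q ^- k)%:E)%E.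
  elim: k => [|k IH]; last first.
    by have := nextP (word k); rewrite size_word; apply.
  rewrite expr0 invr1; apply: le_lt_trans lt1; apply: lee_nneseries => i.
    by rewrite lee_fin cylinder_mass_ge0.
  by rewrite lee_fin /cylinder_mass max0n ler_piMl // ?invr_ge0 ?exprn_ge0 ?lern1 ?leq_b1 // ltW.
pose x k := next (word k).
have word_nth k j : (j < k)%N -> nth a0 (word k) j = x j.
  elim: k => // k IH; rewrite ltnS leq_eqVlt /= nth_rcons size_word.
  by case/predU1P => [->|jk]; rewrite ?ltnn ?eqxx // jk IH.
(* The limit word [x] lies in some cylinder [i]. Its prefix of length [n i] spans exactly that
   cylinder, so the [i]-th term alone already gives mass [q ^- n i], contradicting [mass_word]. *)
have [i xi] := cover x.
have := mass_word (n i); rewrite ltNge => /negP; apply.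
have m0 k : (0 <= (cylinder_mass a0 (c k) (n k) (word (n i)))%:E)%E.
  by rewrite lee_fin cylinder_mass_ge0.
rewrite /mass (nneseriesD1 (n := i)) //; apply: le_trans (leeDl _ _); last first.
  by apply: nneseries_ge0 => k _ _.
rewrite lee_fin /cylinder_mass /cylinder_compat size_word maxnn.
case: asboolP => [_|nc]; first by rewrite mul1r.
by exfalso; apply: nc => j _ jn; rewrite word_nth // xi.
Qed.

End CylinderCover.

(** A section of [f] picks one representative in each coset, so [T] enumerates the cosets without
    repetition. *)
Lemma index_in_classifier (G : topologicalGroupType) (N : set G) (T : finType)
    (f : G -> T) :
  (forall t, exists x, f x = t) ->
  (forall x y, f x = f y <->
    [set (x * z)%g | z in N] = [set (y * z)%g | z in N]) ->
  index_in setT N = #|T|.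
Proof.
move=> /choice[g fg] fN.
have cosetsE : left_cosets setT N =
    (fun i : 'I_#|T| => [set (g (enum_val i) * z)%g | z in N]) @` setT.
  apply/seteqP; split=> [_ [x _ <-]|_ [i _ <-]]; last by exists (g (enum_val i)).
  by exists (enum_rank (f x)) => //; apply/fN; rewrite fg enum_rankK.
have cardE : (left_cosets setT N #= `I_#|T|)%card.
  rewrite cosetsE; apply: card_eq_trans (card_esym card_II).
  apply: inj_card_eq => i j _ _ /fN; rewrite !fg; exact: enum_val_inj.
exact: card_fset_set.
Qed.

(** * The filtrations of slope [c]: indices and distances *)

Section SlopeFiltration.
Variables (R : realType) (K : finFieldType).
Implicit Types (x y : riordan K) (c n m : nat).

Fact riordan_of_subproof (a b : nat -> K) :
  [&& oapp a 1 (if 0%N is k.+1 then Some k else None) == 1,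
      (if 0%N is k.+2 then b k else (0 == 1)%N%:R) == 0 &
      (if 1%N is k.+2 then b k else (1 == 1)%N%:R) == 1].
Proof. by rewrite /= !eqxx. Qed.

Definition riordan_of (a b : nat -> K) : riordan K :=
  @Riordan K (fun n => oapp a 1 (if n is k.+1 then Some k else None))
    (fun n => if n is k.+2 then b k else (n == 1)%N%:R) (riordan_of_subproof a b).

(** Coordinates on the quotient by [riordan_ker n.+1 m.+2]; the shifts skip the coefficients that
    are fixed in every Riordan pair. *)
Definition riordan_digits n m x : {ffun 'I_n -> K} * {ffun 'I_m -> K} :=
  ([ffun i : 'I_n => rh x i.+1], [ffun j : 'I_m => rg x j.+2]).

Lemma riordan_digitsP n m x y :
  riordan_digits n m x = riordan_digits n m y <-> riordan_eqm n.+1 m.+2 x y.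
Proof.
split=> [[/ffunP hE /ffunP gE]|[hE gE]].
  split=> [[|k] kn|[|[|k]] km]; rewrite ?rh0 ?rg0 ?rg1 //.
    by have := hE (Ordinal (kn : (k < n)%N)); rewrite !ffunE.
  by have := gE (Ordinal (km : (k < m)%N)); rewrite !ffunE.
by congr pair; apply/ffunP => i; rewrite !ffunE; [apply: hE|apply: gE];
  rewrite ?ltnS.
Qed.

Lemma riordan_digits_surj n m t : exists x, riordan_digits n m x = t.
Proof.
case: t => a b; exists (riordan_of (fun k => oapp a 0 (insub k))
                                   (fun k => oapp b 0 (insub k))).
by congr pair; apply/ffunP => i; rewrite !ffunE /= valK.
Qed.

(** The [n + m] digits label the cosets. The hypothesis says [n.+1 <= m.+2], the condition under
    which cosets are congruence classes. *)
Lemma riordan_ker_index n m : (n <= m.+1)%N ->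
  index_in setT (@riordan_ker K n.+1 m.+2) = (#|K| ^ (n + m))%N.
Proof.
move=> nm; have NE x y : riordan_digits n m x = riordan_digits n m y <->
    [set (x * z)%g | z in @riordan_ker K n.+1 m.+2] =
    [set (y * z)%g | z in @riordan_ker K n.+1 m.+2].
  rewrite !riordan_left_coset // riordan_digitsP; split=> [xy|->//].
  apply/seteqP; split=> z; last exact: riordan_eqm_trans xy.
  exact: riordan_eqm_trans (riordan_eqm_sym xy).
by rewrite (index_in_classifier (@riordan_digits_surj n m) NE)
  card_prod !card_ffun !card_ord expnD.
Qed.

Definition slope_filtration c n : set (riordan K) :=
  riordan_ker n.+1 (c * n).+2.

Lemma slope_filtration_le c m n : (m <= n)%N ->
  slope_filtration c n `<=` slope_filtration c m.
Proof.
by move=> mn x; apply: riordan_eqm_le; rewrite ?ltnS // leq_mul2l mn orbT.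
Qed.

Lemma slope_filtration0 c x : slope_filtration c 0%N x.
Proof.
split=> [[|k] //= _|]; first by rewrite rh0.
by rewrite muln0 => -[|[|k]] //= _; rewrite ?rg0 ?rg1.
Qed.

Lemma slope_filtrationP c : (0 < c)%N -> is_filtration (slope_filtration c).
Proof.
move=> c0; have ncn n : (n <= c * n)%N by rewrite leq_pmull.
split.
- by apply/seteqP; split=> // x _; apply: slope_filtration0.
- by move=> n; apply: slope_filtration_le.
- move=> n; split; first exact: riordan_ker_open.
  by apply: riordan_ker_normal; rewrite !ltnS leqW.
- move=> B /riordan_nbhsP[n Bn]; exists n => x xF; rewrite -[x]mul1g; apply: Bn.
  by apply/riordan_base_cong; apply: riordan_eqm_le xF; rewrite ?ltnS ?leqW.
Qed.

Let q : R := #|K|%:R.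

Lemma card_gt1R : 1 < q.
Proof. by rewrite ltr1n card_finNzRing_gt1. Qed.

Lemma slope_filtration_index c n : (0 < c)%N ->
  (index_in setT (slope_filtration c n))%:R = (q ^+ n) ^+ c.+1.
Proof.
move=> c0; rewrite riordan_ker_index; last by rewrite leqW // leq_pmull.
by rewrite natrX -exprM mulnS mulnC.
Qed.

Local Notation d c := (filtration_dist R (slope_filtration c)).

Lemma slope_dist_ge0 c x y : 0 <= d c x y.
Proof.
apply: lb_le_inf; last by move=> _ [n _ <-]; rewrite invr_ge0.
exists ((index_in setT (slope_filtration c 0%N))%:R^-1).
by exists 0%N => //; apply: slope_filtration0.
Qed.

Lemma slope_dist_le c n x y : (0 < c)%N ->
  riordan_eqm n.+1 (c * n).+2 x y -> d c x y <= (q ^+ n) ^- c.+1.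
Proof.
move=> c0 xy; rewrite -slope_filtration_index //; apply: ge_inf.
  by exists 0 => _ [k _ <-]; rewrite invr_ge0.
exists n => //=; apply/mem_riordan_ker_mulV => //.
by rewrite !ltnS leqW // leq_pmull.
Qed.

(** Since the chain descends, points separated at level [n.+1] are congruent only at levels
    [k <= n], where the inverse index is at least that of level [n]. *)
Lemma slope_dist_ge c n x y : (0 < c)%N ->
  ~ riordan_eqm n.+2 (c * n.+1).+2 x y -> (q ^+ n) ^- c.+1 <= d c x y.
Proof.
move=> c0 xy; apply: lb_le_inf.
  exists ((index_in setT (slope_filtration c 0%N))%:R^-1).
  by exists 0%N => //; apply: slope_filtration0.
move=> _ [k /= xyk <-]; rewrite slope_filtration_index // -!exprM.
rewrite ler_pV2 ?inE ?unitfE ?expf_neq0 ?exprn_gt0 ?gt_eqF ?(lt_trans _ card_gt1R) //.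
rewrite ler_eXn2l ?card_gt1R // leq_mul2r leqNgt; apply/negP => nk; apply: xy.
have ab : (n.+2 <= (c * n.+1).+2)%N by have := leq_pmull n.+1 c0; lia.
by apply/(mem_riordan_ker_mulV _ _ ab); apply: slope_filtration_le xyk.
Qed.

End SlopeFiltration.

(** * The Hausdorff dimension of [H] for the filtration of slope [c] *)

Section HausdorffDimensionOfH.
Variables (R : realType) (K : finFieldType) (c : nat).
Hypothesis c_gt0 : (0 < c)%N.

Let q : R := #|K|%:R.
Let q1 : 1 < q := card_gt1R R K.
Let q_gt0 : 0 < q := lt_trans ltr01 q1.
Let d := filtration_dist R (slope_filtration (K := K) c).
Let H := riordan_index K setT set0.

Lemma invX_powR (u s : R) k : 1 <= u -> (u ^- k) `^ s = u `^ (- (k%:R * s)).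
Proof.
move=> u1; have u0 : 0 <= u by apply: le_trans u1.
by rewrite -powR_mulrn // -powRN -powRrM mulNr.
Qed.

Lemma exists_expr_ge (M : R) : exists n, M <= q ^+ n.
Proof.
exists (Num.bound `|M|); apply: le_trans (ler_norm M) _.
apply/ltW/(lt_le_trans (archi_boundP (normr_ge0 M))).
rewrite -natrX ler_nat ltnW // ltn_expl //.
by rewrite -(ltr1n R).
Qed.

(** Take the last level [n] at which all points of [U] agree: two points differ at level [n.+1], so
    the diameter is at least [q^(-n(c+1))], and its power [s] at least [q^(-n)]. If there is no last
    level, [U] has at most one point and the slack [e] absorbs a cylinder of small measure. *)
Lemma gauge_ge_cylinder s (U : set (riordan K)) (e : R) :
  0 <= s -> c.+1%:R * s <= 1 -> 0 < e ->
  exists n a, ((q ^- n)%:E <= hausdorff_gauge d s U + e%:E)%E /\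
    forall x, U x -> forall j, (j < n)%N -> rh x j.+1 = a j.
Proof.
move=> s0 cs1 e0.
have g0 : (0 <= hausdorff_gauge d s U)%E.
  by rewrite /hausdorff_gauge; case: ifP => // _; apply: poweR_ge0.
have coeffs n : (forall x y, U x -> U y -> riordan_eqm n.+1 (c * n).+2 x y) ->
    exists a, forall x, U x -> forall j, (j < n)%N -> rh x j.+1 = a j.
  move=> Un; have [->|/set0P[y Uy]] := eqVneq U set0; first by exists (fun=> 0).
  by exists (fun j => rh y j.+1) => x Ux j jn; have [-> //] := Un _ _ Ux Uy.
have [all_n|] := pselect (forall n x y, U x -> U y ->
    riordan_eqm n.+1 (c * n).+2 x y).
  have [n en] := exists_expr_ge e^-1; have [a Ua] := coeffs n (all_n n).
  exists n, a; split=> //; apply: (@le_trans _ _ e%:E); last exact: leeDr.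
  by rewrite lee_fin -[e]invrK lef_pV2 // posrE ?exprn_gt0 ?invr_gt0.
move=> /existsNP/cid[m0 Um0].
pose bad m := `[< ~ forall x y, U x -> U y -> riordan_eqm m.+1 (c * m).+2 x y >].
have ex_bad : exists m, bad m by exists m0; apply/asboolP.
(* Level 0 is the whole group and never bad, so the least bad level is a successor [n.+1], and level
   [n] is good. *)
have [[|n] /asboolP badn minn] := ex_minnP ex_bad.
  case: badn => x y _ _.
  exact: riordan_eqm_trans (slope_filtration0 c x)
    (riordan_eqm_sym (slope_filtration0 c y)).
have good x y : U x -> U y -> riordan_eqm n.+1 (c * n).+2 x y.
  have [//|bn] := pselect (forall x y, U x -> U y -> riordan_eqm n.+1 (c * n).+2 x y).
    by move=> h; apply: h.
  by have := minn n; rewrite ltnn => /(_ (asboolT bn)).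
have [a Ua] := coeffs n good; exists n, a; split=> //.
move/existsNP : badn => [x] /existsNP[y] /not_implyP[Ux] /not_implyP[Uy xy].
have U0 : U != set0 by apply/set0P; exists x.
rewrite /hausdorff_gauge (negPf U0).
have qn1 : 1 <= q ^+ n by rewrite exprn_ege1 // ltW.
apply: (@le_trans _ _ (((q ^+ n) ^- c.+1)%:E `^ s)%E).
  rewrite poweR_EFin lee_fin invX_powR // -[X in X <= _]powR_inv1 ?(le_trans ler01) //.
  by apply: ler_powR => //; rewrite lerN2.
rewrite -[X in (X <= _)%E]adde0; apply: leeD; last by rewrite lee_fin ltW.
have dU : (((q ^+ n) ^- c.+1)%:E <= diameter d U)%E.
  apply: (@le_trans _ _ (d x y)%:E).
    by rewrite lee_fin; apply: slope_dist_ge.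
  by apply: ereal_sup_ubound; exists (x, y).
have q0 : (0 <= ((q ^+ n) ^- c.+1)%:E)%E.
  by rewrite lee_fin invr_ge0 !exprn_ge0 // ltW.
apply: gt0_ler_poweR => //; rewrite in_itv /= ?leey ?andbT //.
exact: le_trans dU.
Qed.

(** Each set of a cover is replaced by a cylinder, with errors [e / 2^(i+1)] of total at most [e].
    Every sequence of coefficients comes from an element of [H], so these cylinders cover all words
    and [cylinder_cover_mass] applies. *)
Lemma hausdorff_content_ge1 s delta : 0 <= s -> c.+1%:R * s <= 1 ->
  (1 <= hausdorff_content d s delta H)%E.
Proof.
move=> s0 cs1; apply: le_ereal_inf_tmp => _ [U [HU _] <-].
apply/lee_addgt0Pr => e e0.
have ei i : 0 < e / (2 ^ i.+1)%:R :> R by rewrite divr_gt0 // ltr0n expn_gt0.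
have g0 i : (0 <= hausdorff_gauge d s (U i))%E.
  by rewrite /hausdorff_gauge; case: ifP => // _; apply: poweR_ge0.
have /choice[na naP] : forall i, exists na : nat * (nat -> K),
    ((q ^- na.1)%:E <= hausdorff_gauge d s (U i) + (e / (2 ^ i.+1)%:R)%:E)%E /\
    forall x, U i x -> forall j, (j < na.1)%N -> rh x j.+1 = na.2 j.
  move=> i; have [n [a na]] := gauge_ge_cylinder (U i) s0 cs1 (ei i).
  by exists (n, a).
apply: le_trans (epsilon_trick xpredT g0 (ltW e0)).
apply: (@le_trans _ _ (\sum_(0 <= i <oo) (q ^- (na i).1)%:E)%E).
  apply: (@cylinder_cover_mass _ _ (fun i => (na i).2)) => x.
  have [|i _ Ui] := HU (riordan_of x (fun=> 0)).
    by split=> [k _ []|[|j]].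
  by exists i => j jn; have [_ /(_ _ Ui j jn)<-] := naP i.
apply: lee_nneseries => i _; last by have [] := naP i.
by rewrite lee_fin invr_ge0 exprn_ge0 // ltW.
Qed.

(** With [u = q^n], the [u] cosets meeting [H] have diameter at most [u^(-(c+1))], so their gauges
    add up to at most [u * u^(-(c+1)s) = u^(-eta)], which tends to 0. *)
Lemma hausdorff_content_le s (e delta : R) : 1 < c.+1%:R * s -> 0 < e -> 0 < delta ->
  (hausdorff_content d s delta H <= e%:E)%E.
Proof.
move=> cs1 e0 delta0; set eta := c.+1%:R * s - 1.
have eta0 : 0 < eta by rewrite subr_gt0.
have s0 : 0 <= s by rewrite -(pmulr_rge0 _ (ltr0Sn R c)) (le_trans _ (ltW cs1)).
(* The first bound on [q^n] makes the diameters at most [delta], the second makes [u^(-eta)] at most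
   [e]. *)
have [n] := exists_expr_ge (Num.max delta^-1 (e `^ (- eta^-1))).
set u := q ^+ n; rewrite ge_max => /andP[du eu].
have u1 : 1 <= u by rewrite exprn_ege1 // ltW.
have u0 : 0 < u by apply: lt_le_trans u1.
pose N := #|{ffun 'I_n -> K}|.
(* Digits of the first component suffice, because the second one is [x] throughout [H]. The cover
   must be an infinite sequence; its sets are empty from [N] on. *)
pose U i := [set x | H x /\ enum_rank (riordan_digits n 0 x).1 = i :> nat].
have Udiam i : U i !=set0 -> (0 <= diameter d (U i) <= (u ^- c.+1)%:E)%E.
  move=> [x Ux]; apply/andP; split.
    apply: (@le_trans _ _ (d x x)%:E); first by rewrite lee_fin slope_dist_ge0.
    by apply: ereal_sup_ubound; exists (x, x).
  apply: ge_ereal_sup => _ [[y z] [/= [Hy iy] [Hz iz]] <-].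
  rewrite lee_fin; apply: slope_dist_le => //.
  have /riordan_digitsP[hE _] : riordan_digits n 0 y = riordan_digits n 0 z.
    congr pair; last by apply/ffunP => -[].
    by apply/enum_rank_inj/val_inj; rewrite /= iy iz.
  have [/riordan_index_set0P-/(_ setT)[_ gy] /riordan_index_set0P-/(_ setT)[_ gz]] := (Hy, Hz).
  by split=> // k _; rewrite gy gz.
have gU i : (hausdorff_gauge d s (U i) <= if (i < N)%N then ((u ^- c.+1) `^ s)%:E else 0)%E.
  rewrite /hausdorff_gauge; case: eqVneq => [_|/set0P Ui].
    by case: ifP => // _; rewrite lee_fin powR_ge0.
  have /andP[d0 dle] := Udiam i Ui.
  have iN : (i < N)%N by case: Ui => x [_ <-]; apply: ltn_ord.
  rewrite iN -poweR_EFin; apply: gt0_ler_poweR => //; rewrite in_itv /= ?leey ?andbT //.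
  exact: le_trans dle.
have gU0 i : (0 <= hausdorff_gauge d s (U i))%E.
  by rewrite /hausdorff_gauge; case: ifP => // _; apply: poweR_ge0.
apply: (@le_trans _ _ (\sum_(0 <= i <oo) hausdorff_gauge d s (U i))%E).
  apply: ereal_inf_lbound; exists U => //; split=> [x Hx|i].
    by exists (enum_rank (riordan_digits n 0 x).1).
  have [/Udiam/andP[_ /le_trans->//]|/set0P/negP/negPn/eqP->] := pselect (U i !=set0).
    rewrite lee_fin -[delta]invrK lef_pV2 ?posrE ?exprn_gt0 ?invr_gt0 //.
    by apply: le_trans du _; apply: ler_eXnr.
  (* The diameter of the empty set is the supremum of no values, [-oo]. *)
  by rewrite /diameter set0X image_set0 ereal_sup0 leNye.
apply: le_trans (lee_nneseries _ (fun i _ => gU i)) _ => //.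
rewrite (nneseries_split 0 N); last by move=> k _; case: ifP => // _; rewrite lee_fin powR_ge0.
rewrite eseries0; last by move=> i; rewrite add0n leqNgt => /negPf->.
rewrite adde0 add0n big_mkord.
under eq_bigr => i _ do rewrite ltn_ord.
rewrite sumEFin lee_fin sumr_const card_ord -mulr_natr invX_powR //.
have -> : N%:R = u :> R by rewrite /N card_ffun card_ord natrX.
rewrite -[X in _ * X](powRr1 (ltW u0)) -powRD; last by rewrite (gt_eqF u0) implybT.
have -> : - (c.+1%:R * s) + 1 = - eta by rewrite /eta opprB addrC.
rewrite powRN -[e]invrK lef_pV2 ?posrE ?powR_gt0 ?invr_gt0 //.
have -> : e^-1 = (e `^ (- eta^-1)) `^ eta.
  by rewrite -powRrM mulNr mulVf ?gt_eqF // powR_inv1 // ltW.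
by apply: ge0_ler_powR; rewrite ?nnegrE ?powR_ge0 // ltW.
Qed.

(** For [s < 1/(c+1)] the content at scale 1 is at least 1, so the measure is not zero. For every
    [s = 1/(c+1) + e] with [e > 0] the contents vanish at all scales. *)
Lemma filtration_dim_H :
  filtration_dim R (slope_filtration (K := K) c) H = ((c.+1%:R)^-1)%:E.
Proof.
have c1 : 0 < c.+1%:R :> R by rewrite ltr0Sn.
apply/eqP; rewrite eq_le; apply/andP; split; last first.
  apply: le_ereal_inf_tmp => _ [s [s0 ms0] <-]; rewrite lee_fin leNgt; apply/negP => sc.
  have := hausdorff_content_ge1 1 s0.
  rewrite -[X in _ <= X](mulfV (lt0r_neq0 c1)) ler_pM2l // => /(_ (ltW sc)).
  move=> content1.
  have : (hausdorff_content d s 1 H <= hausdorff_measure d s H)%E.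
    by apply: ereal_sup_ubound; exists 1 => /=.
  by rewrite ms0 leNgt (lt_le_trans _ content1).
apply/lee_addgt0Pr => e e0; rewrite -EFinD; apply: ereal_inf_lbound.
have cs : 1 < c.+1%:R * (c.+1%:R^-1 + e) by rewrite mulrDr mulfV ?gt_eqF // ltrDl mulr_gt0.
exists (c.+1%:R^-1 + e) => //; split; first by rewrite addr_ge0 ?invr_ge0 // ltW.
apply/eqP; rewrite eq_le; apply/andP; split.
  apply: ge_ereal_sup => _ [delta delta0 <-]; apply/lee_addgt0Pr => r r0.
  by rewrite add0e; apply: hausdorff_content_le.
apply: (@le_trans _ _ (hausdorff_content d (c.+1%:R^-1 + e) 1 H)).
  apply: le_ereal_inf_tmp => _ [U _ <-]; apply: nneseries_ge0 => i _ _.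
  by rewrite /hausdorff_gauge; case: ifP => // _; apply: poweR_ge0.
by apply: ereal_sup_ubound; exists 1 => /=.
Qed.

End HausdorffDimensionOfH.

Local Close Scope ring_scope.

Theorem mainTheorem3 (R : realType) (p : nat) (p_prime : prime p) :
  (exists (F1 F2 : nat -> set (riordan 'F_p)) (H : set (riordan 'F_p)),
      [/\ is_filtration F1, is_filtration F2, is_subgroup H, closed H
        & filtration_dim R F1 H <> filtration_dim R F2 H]) /\
  (forall I J : set nat, admissible 'F_p I J ->
      just_infinite (riordan_index 'F_p I J) -> I = set0 \/ J = set0).
Proof.
split; last by move=> I J; apply: riordan_index_just_infinite.
exists (slope_filtration 1), (slope_filtration 2), (riordan_index 'F_p setT set0).
split.
- exact: slope_filtrationP.
- exact: slope_filtrationP.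
(* [R(setT, setT)] is the whole group, in which [H] is the kernel of the second projection. *)
- have sgT : is_subgroup (riordan_index 'F_p setT setT).
    by apply/is_subgroupP; split=> [|x y _ _]; split=> k _ /(_ I).
  by have [] := riordan_index_set0_normal sgT.
- exact: closed_riordan_index.
(* The two dimensions are [1/2] and [1/3]. *)
rewrite !filtration_dim_H // => -[] /invr_inj /eqP.
by rewrite eqr_nat.
Qed.
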